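(* Let $m\ge 1$ and $n\geq 1$ be integers, and let $x_1,\dots,x_n$ be indeterminates. Let $\mathcal{D}_{m,n}$ be the set of all dispositions $D=(D_1,\dots,D_n)$ from $[m]$ to $[n]$, and let $\mathrm{RLmin}(D_i)$ be the number of right-to-left minima of $D_i$. Then $$\sum_{D\in \mathcal{D}_{m,n}}\ \prod_{i=1}^n x_i^{\mathrm{RLmin}(D_i)}=\prod_{k=0}^{m-1}(x_1+x_2+\cdots+x_n+k).$$
   Context: For a nonnegative integer $k$, $[k]=\{1,2,\dots,k\}$. A disposition from $[m]$ to $[n]$ is a function $f:[m]\to[n]$ together with a linear order on each pre-image $f^{-1}(i)$, $i\in[n]$. It is written $D=(D_1,D_2,\dots,D_n)$, where $D_i$ is the (possibly empty) sequence listing the elements of $f^{-1}(i)$ in the chosen linear order; thus the concatenation $D_1D_2\cdots D_n$ is a permutation of $[m]$. For a sequence $\pi=\pi_1\pi_2\cdots\pi_k$ of distinct integers, $\pi_i$ is a right-to-left minimum if $\pi_i<\pi_j$ for every $j>i$ (so the last entry is always a right-to-left minimum); the empty sequence has $0$ right-to-left minima. *)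

(* Defs.v *)
From mathcomp Require Import all_boot.

Set Implicit Arguments.
Unset Strict Implicit.
Unset Printing Implicit Defensive.

(* The sets [m] = {1, ..., m} and [n] = {1, ..., n} are encoded as 'I_m and
   'I_n, i.e. with all entries shifted down by one; only the order of the
   entries matters below. *)

(* Each order is given by its graph, which is required to be contained in
   A x A, so that distinct elements r are distinct linear orders on A. *)
Definition linear_order_on (T : finType) (A : {set T}) (r : {set T * T}) : bool :=
  [&& r \subset setX A A,
      [forall x in A, (x, x) \in r],
      [forall x, forall y, ((x, y) \in r) && ((y, x) \in r) ==> (x == y)],
      [forall x, forall y, forall z,
         ((x, y) \in r) && ((y, z) \in r) ==> ((x, z) \in r)]
    & [forall x in A, forall y in A, ((x, y) \in r) || ((y, x) \in r)]].

Section Dispositions.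

Variables m n : nat.

Definition predisposition : finType :=
  ({ffun 'I_m -> 'I_n} * {ffun 'I_n -> {set 'I_m * 'I_m}})%type.

Definition fiber (D : predisposition) (i : 'I_n) : {set 'I_m} :=
  [set a | D.1 a == i].

Definition dispositions : {set predisposition} :=
  [set D : predisposition | [forall i, linear_order_on (fiber D i) (D.2 i)]].

(* The sequence D_i; (a, b) \in D.2 i means that a precedes or equals b
   in D_i. *)
Definition block (D : predisposition) (i : 'I_n) : seq 'I_m :=
  sort (fun a b => (a, b) \in D.2 i) (enum (fiber D i)).

End Dispositions.

Definition is_rlmin (s : seq nat) (i : 'I_(size s)) : bool :=
  [forall j : 'I_(size s), (i < j) ==> (tnth (in_tuple s) i < tnth (in_tuple s) j)].

Definition RLmin (s : seq nat) : nat := #|[set i : 'I_(size s) | is_rlmin i]|.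

(* Main.v *)
Require Import Defs.
From HB Require Import structures.
From mathcomp Require Import all_boot all_order all_algebra.
From mathcomp Require Import mpoly.

Set Implicit Arguments.
Unset Strict Implicit.
Unset Printing Implicit Defensive.

Import GRing.Theory.
Local Open Scope ring_scope.

(** Build a disposition by inserting the letters from the smallest to the
    largest.  When a letter larger than the k letters already present is
    inserted, it goes either to the end of one of the n sequences or just
    before one of the k letters.  At the end of the i-th sequence it becomes a
    new right-to-left minimum, which multiplies the weight by x_i; before
    another letter it is not a right-to-left minimum; and in no case does it
    change the status of the other letters, being larger than all of them
    ([RLmin_insert]).  Hence the insertion step multiplies the sum of the
    weights by x_1 + ... + x_n + k ([sum_weight_slots]).

    The induction is carried out on families of n sequences of natural numbers
    rather than on dispositions, whose types depend on m: [layouts m] lists the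
    results of the insertions, and [mem_layouts] and [layouts_uniq] say that it
    lists each arrangement of the letters below m exactly once.  Dispositions
    are transported to these families by [word]; since a linear order on a
    finite set amounts to a listing of its elements ([precedence_sort],
    [sort_precedence]), this is a bijection ([perm_words]). *)

(** * Linear orders on a finite set as duplicate-free sequences *)

Section LinearOrders.

Variable T : finType.
Implicit Types (A : {set T}) (r : {set T * T}) (s t : seq T).

Definition rel_of r : rel T := fun a b => (a, b) \in r.

Lemma linear_order_onP A r :
  reflect [/\ r \subset setX A A, {in A, reflexive (rel_of r)},
              antisymmetric (rel_of r), transitive (rel_of r)
            & {in A &, total (rel_of r)}]
          (linear_order_on A r).
Proof.
apply: (iffP and5P) => -[rA refl_r asym_r trans_r tot_r]; split => //.
- exact/forall_inP.
- by move=> a b; move/forallP/(_ a)/forallP/(_ b)/implyP: asym_r => h /h/eqP.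
- move=> b a c ab bc.
  move/forallP/(_ a)/forallP/(_ b)/forallP/(_ c)/implyP: trans_r; apply.
  exact/andP.
- by move=> a b aA bA; move/forall_inP/(_ a aA)/forall_inP/(_ b bA): tot_r.
- exact/forall_inP.
- by apply/forallP=> a; apply/forallP=> b; apply/implyP=> /asym_r/eqP.
- apply/forallP=> a; apply/forallP=> b; apply/forallP=> c; apply/implyP.
  by case/andP; apply: trans_r.
- by apply/forall_inP=> a aA; apply/forall_inP=> b bA; apply: tot_r.
Qed.

Definition precedence s : {set T * T} :=
  [set p | [&& p.1 \in s, p.2 \in s & (index p.1 s <= index p.2 s)%N]].

Lemma precedence_linear A s : A =i s -> linear_order_on A (precedence s).
Proof.
move=> As; apply/linear_order_onP; rewrite /rel_of; split.
- by apply/subsetP=> -[a b]; rewrite !inE /= !As => /and3P[-> ->].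
- by move=> a; rewrite As inE /= leqnn => ->.
- move=> a b; rewrite !inE /= => /andP[/and3P[sa sb le_ab] /and3P[_ _ le_ba]].
  by apply: (index_inj a sa sb); apply/eqP; rewrite eqn_leq le_ab.
- move=> b a c; rewrite !inE /= => /and3P[-> _ le_ab] /and3P[_ -> le_bc] /=.
  exact: leq_trans le_bc.
- by move=> a b; rewrite !As !inE /= => -> ->; apply: leq_total.
Qed.

Lemma sorted_precedence s : uniq s -> sorted (rel_of (precedence s)) s.
Proof.
move=> Us; case def_s: s => [|a0 s0] //; rewrite -def_s.
apply/(sortedP a0) => i lt_i; have lt_i1 := ltnW lt_i.
by rewrite /rel_of inE /= !mem_nth // !index_uniq // leqnSn.
Qed.

Lemma sort_enum_linear A r : linear_order_on A r ->
  sorted (rel_of r) (sort (rel_of r) (enum A)).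
Proof.
case/linear_order_onP=> _ _ _ _ tot_r; apply: (sort_sorted_in tot_r).
by apply/allP=> a; rewrite mem_enum.
Qed.

(** Together with [precedence_sort], this makes linear orders on [A] and
    duplicate-free listings of [A] two encodings of the same objects. *)
Lemma sort_precedence A s : A =i s -> uniq s ->
  sort (rel_of (precedence s)) (enum A) = s.
Proof.
move=> As Us; have linA := precedence_linear As.
case/linear_order_onP: (linA) => _ _ asym_r trans_r _.
apply: (@sorted_eq _ (rel_of (precedence s))) => //.
- exact: sort_enum_linear.
- exact: sorted_precedence.
- rewrite perm_sort; apply: uniq_perm => // [|a]; first exact: enum_uniq.
  by rewrite mem_enum.
Qed.

(** The sorted enumeration of [A] determines the linear order: two elements
    compare as their positions do, by transitivity in one direction and by
    antisymmetry in the other. *)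
Lemma precedence_sort A r : linear_order_on A r ->
  precedence (sort (rel_of r) (enum A)) = r.
Proof.
move=> linA; have sorted_s := sort_enum_linear linA.
case/linear_order_onP: linA => rA refl_r asym_r trans_r tot_r.
set s := sort _ _ in sorted_s *.
have As a : (a \in s) = (a \in A) by rewrite mem_sort mem_enum.
have le_r a b : a \in A -> b \in A -> (index a s <= index b s)%N -> (a, b) \in r.
  move=> aA bA; apply: (sorted_leq_index_in (leT := rel_of r)) => //.
  - by move=> ? ? ? _ _ _; apply: trans_r.
  - by move=> c; rewrite As; apply: refl_r.
  - by rewrite As.
  - by rewrite As.
apply/setP=> -[a b]; rewrite inE /= !As.
apply/and3P/idP => [[aA bA]|ab]; first exact: le_r.
have:= subsetP rA _ ab; rewrite in_setX /= => /andP[aA bA]; split=> //.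
case: leqP => // lt_ba; have ba := le_r b a bA aA (ltnW lt_ba).
have eq_ab : a = b by apply: asym_r; apply/andP.
by rewrite eq_ab ltnn in lt_ba.
Qed.

End LinearOrders.

(** * Right-to-left minima *)

Lemma RLmin_cons a s : RLmin (a :: s) = (all (ltn a) s + RLmin s)%N.
Proof.
rewrite /RLmin -!sum1dep_card big_mkcond /= big_ord_recl; congr addn.
  set b1 := is_rlmin _; suff -> : b1 = all (ltn a) s by case: all.
  apply/forallP/(all_nthP 0%N) => [min_a i lt_i | min_a [[|i] lt_i]] //=.
    by have /implyP/(_ isT) := min_a (lift ord0 (Ordinal lt_i));
      rewrite !(tnth_nth 0%N).
  by rewrite !(tnth_nth 0%N) /=; apply: min_a.
rewrite [RHS]big_mkcond; apply: eq_bigr => i _; congr (if _ then _ else _).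
apply/forallP/forallP => min_i j.
  by have := min_i (lift ord0 j); rewrite !(tnth_nth 0%N).
case: (unliftP ord0 j) => [k|] -> //=.
by have := min_i k; rewrite !(tnth_nth 0%N).
Qed.

Lemma RLmin_nil : RLmin [::] = 0%N.
Proof. by rewrite /RLmin -sum1dep_card big_mkcond big_ord0. Qed.

Definition insert (p a : nat) (s : seq nat) := take p s ++ a :: drop p s.

(** A letter larger than all the others never prevents a letter before it
    from being a right-to-left minimum, and is itself one exactly when nothing
    comes after it. *)
Lemma RLmin_insert p a s : all (gtn a) s -> (p <= size s)%N ->
  RLmin (insert p a s) = (RLmin s + (p == size s))%N.
Proof.
rewrite /insert; elim: s p => [|b s IHs] [|p] //=.
- by rewrite RLmin_cons RLmin_nil.
- case/andP=> lt_ba _ _; rewrite RLmin_cons /= (ltnNge a b) (ltnW lt_ba) /=.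
  by rewrite addn0.
case/andP=> lt_ba lt_sa le_p; rewrite !RLmin_cons IHs // addnA eqSS.
congr (_ + _ + _)%N; rewrite all_cat /= lt_ba /= -all_cat.
by rewrite cat_take_drop.
Qed.

(** * Arrangements of the letters below m in n sequences *)

Section Layouts.

Variable n : nat.
Implicit Types (T : {ffun 'I_n -> seq nat}) (i : 'I_n).

(** Counting occurrences over all the sequences at once says both that every
    letter below [m] is used and that none is repeated, within a sequence or
    between two of them; it also behaves additively under insertion. *)
Definition is_layout m T :=
  forall x, (\sum_i count_mem x (T i))%N = (x < m)%N.

Lemma layout_count m T i x : is_layout m T ->
  (count_mem x (T i) <= (x < m))%N.
Proof. by move=> /(_ x) <-; rewrite (bigD1 i) //= leq_addr. Qed.

Lemma layout_bound m T i : is_layout m T -> all (gtn m) (T i).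
Proof.
move=> PT; apply/allP=> x /=; rewrite -has_pred1 has_count => x_gt0.
by have := leq_trans x_gt0 (layout_count i x PT); case: (x < m)%N.
Qed.

Lemma layout_uniq m T i : is_layout m T -> uniq (T i).
Proof.
move=> PT; apply: count_mem_uniq => x.
rewrite -has_pred1 has_count; have := leq_trans (layout_count i x PT) (leq_b1 _).
by case: count => [|[]].
Qed.

Lemma layout_inj m T i j x : is_layout m T ->
  x \in T i -> x \in T j -> i = j.
Proof.
move=> PT; rewrite -!has_pred1 !has_count => xi xj.
apply/eqP; have := leq_b1 (x < m)%N; apply: contraTT => ne_ij.
rewrite -(PT x) (bigD1 i) //= (bigD1 j) 1?eq_sym //= -ltnNge addnA.
apply: leq_trans (leq_addr _ _); exact: (leq_add xi xj).
Qed.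

Lemma layout_mem m T x : is_layout m T -> (x < m)%N -> exists i, x \in T i.
Proof.
move=> PT lt_xm; have /eqP := PT x; rewrite lt_xm.
case: (boolP [exists i, x \in T i]) => [/existsP // |].
rewrite negb_exists => /forallP none; rewrite big1 // => i _.
exact/count_memPn.
Qed.

Lemma size_sum_count m (s : seq nat) : all (gtn m) s ->
  size s = (\sum_(x < m) count_mem (x : nat) s)%N.
Proof.
elim: s => [|y s IHs] /=; first by rewrite big1.
case/andP=> lt_ym /IHs ->; rewrite big_split /= -add1n; congr addn.
rewrite (bigD1 (Ordinal lt_ym)) //=.
by rewrite eqxx big1 // => x; rewrite -val_eqE eq_sym /= => /negPf ->.
Qed.

Lemma layout_size m T : is_layout m T -> (\sum_i size (T i))%N = m.
Proof.
move=> PT; under eq_bigr => i _ do rewrite (size_sum_count (layout_bound i PT)).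
rewrite exchange_big /=; under eq_bigr => x _ do rewrite PT ltn_ord.
by rewrite sum1_card card_ord.
Qed.

Definition slots T : seq ('I_n * nat) :=
  [seq (i, p) | i <- index_enum 'I_n, p <- index_iota 0 (size (T i)).+1].

Definition insert_at a T (q : 'I_n * nat) : {ffun 'I_n -> seq nat} :=
  [ffun i => if i == q.1 then insert q.2 a (T i) else T i].

Definition erase a T : {ffun 'I_n -> seq nat} :=
  [ffun i => filter (predC1 a) (T i)].

Fixpoint layouts m : seq {ffun 'I_n -> seq nat} :=
  if m is k.+1 then [seq insert_at k T q | T <- layouts k, q <- slots T]
  else [:: [ffun=> [::]]].

Lemma mem_slots T q : (q \in slots T) = (q.2 <= size (T q.1))%N.
Proof.
apply/allpairsPdep/idP => [[i [p [_]]] | le_q].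
  by rewrite mem_index_iota ltnS => /= le_p ->.
by exists q.1, q.2; rewrite mem_index_enum mem_index_iota ltnS; case: q le_q.
Qed.

Lemma slots_uniq T : uniq (slots T).
Proof.
apply: allpairs_uniq_dep => [|i _|[i p] [j q] _ _ /= [-> ->]] //.
  exact: index_enum_uniq.
exact: iota_uniq.
Qed.

Lemma count_insert (P : pred nat) p a s :
  count P (insert p a s) = (P a + count P s)%N.
Proof. by rewrite -[in RHS](cat_take_drop p s) !count_cat /= addnCA. Qed.

Lemma mem_insert_at_max m T q j : is_layout m T ->
  (m \in insert_at m T q j) = (j == q.1).
Proof.
move=> PT; rewrite -has_pred1 has_count ffunE.
have /count_memPn c0 : m \notin T j.
  by apply/negP=> /(allP (layout_bound j PT)) /=; rewrite ltnn.
by case: eqP => _; rewrite ?count_insert /= c0 ?eqxx.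
Qed.

Lemma insert_at_layout m T q : is_layout m T -> is_layout m.+1 (insert_at m T q).
Proof.
move=> PT x.
have cE i : count_mem x (insert_at m T q i)
            = ((i == q.1) * (m == x) + count_mem x (T i))%N.
  by rewrite ffunE; case: eqP => _; rewrite ?count_insert ?mul1n.
under eq_bigr => i _ do rewrite cE.
rewrite big_split /= PT -big_distrl /= (bigD1 q.1) //= eqxx big1 => [|i /negPf->//].
by rewrite addn0 mul1n ltnS [in RHS]leq_eqVlt eq_sym; case: eqP => [->|]; rewrite ?ltnn.
Qed.

Lemma filter_insert_max m p s : all (gtn m) s ->
  filter (predC1 m) (insert p m s) = s.
Proof.
move=> lt_s; rewrite filter_cat /= eqxx -filter_cat cat_take_drop.
apply/all_filterP; apply: sub_all lt_s => x /=.
by rewrite ltn_neqAle => /andP[].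
Qed.

Lemma erase_insert_at m T q : is_layout m T -> erase m (insert_at m T q) = T.
Proof.
move=> PT; apply/ffunP=> j; rewrite !ffunE; case: eqP => _.
  exact/filter_insert_max/layout_bound.
apply/all_filterP; apply: sub_all (layout_bound j PT) => x /=.
by rewrite ltn_neqAle => /andP[].
Qed.

(** The new letter marks the place where it was inserted: it lies in the
    sequence [q.1] only, at position [q.2]. *)
Lemma insert_at_inj m T q q' : is_layout m T ->
  q \in slots T -> q' \in slots T ->
  insert_at m T q = insert_at m T q' -> q = q'.
Proof.
move=> PT; case: q q' => i p [j r]; rewrite !mem_slots /= => le_p le_r eqI.
have eq_ij : i = j.
  apply/eqP; have := mem_insert_at_max (i, p) i PT.
  by rewrite eqI mem_insert_at_max //= eqxx => ->.
subst j; congr pair.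
have idx k : (k <= size (T i))%N -> index m (insert_at m T (i, k) i) = k.
  move=> le_k; rewrite ffunE eqxx /insert /= index_pivot ?size_takel //.
  apply/negP=> /mem_take /(allP (layout_bound i PT)) /=; by rewrite ltnn.
by rewrite -(idx p) // eqI idx.
Qed.

Lemma erase_layout m T : is_layout m.+1 T -> is_layout m (erase m T).
Proof.
move=> PT x; under eq_bigr => i _ do rewrite ffunE count_filter.
have [->|ne_xm] := eqVneq x m.
  rewrite ltnn big1 // => i _; rewrite (eq_count (a2 := pred0)) ?count_pred0 //.
  by move=> y /=; case: eqP.
rewrite (_ : (x < m) = (x < m.+1))%N; last by rewrite ltnS [in RHS]leq_eqVlt (negPf ne_xm).
rewrite -PT; apply: eq_bigr => i _; apply: eq_count => y /=.
by case: eqP => // ->; rewrite ne_xm.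
Qed.

(** The largest letter occurs in one sequence, once,
    so erasing it and putting it back where it was recovers the arrangement. *)
Lemma insert_at_erase m T : is_layout m.+1 T ->
  exists2 q, q \in slots (erase m T) & T = insert_at m (erase m T) q.
Proof.
move=> PT; have [i mi] := layout_mem PT (ltnSn m).
have Ui := layout_uniq i PT; move def_Ti: (T i) mi Ui => s mi.
case/splitPr: mi def_Ti => s1 s2 def_Ti.
rewrite cat_uniq /= negb_or -!andbA => /and5P[_ m1 _ m2 _].
have e_i : erase m T i = s1 ++ s2.
  have no_m t : m \notin t -> filter (predC1 m) t = t.
    by move=> mt; apply/all_filterP/allP=> x xt /=; apply: contraNneq mt => <-.
  by rewrite ffunE def_Ti filter_cat /= eqxx /= !no_m.
exists (i, size s1); first by rewrite mem_slots /= e_i size_cat leq_addr.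
apply/ffunP=> j; rewrite ffunE /=; case: eqP => [->|ne_ji].
  by rewrite e_i /insert take_size_cat // drop_size_cat.
rewrite ffunE; apply/esym/all_filterP/allP=> x xj /=; apply: contra_notN ne_ji.
move/eqP=> def_x; apply: (layout_inj PT xj); rewrite def_x def_Ti.
by rewrite mem_cat mem_head orbT.
Qed.

Lemma mem_layouts m T : T \in layouts m <-> is_layout m T.
Proof.
elim: m T => [|m IHm] T /=.
  rewrite inE; split=> [/eqP-> x | PT]; first by rewrite big1 // => i _; rewrite ffunE.
  apply/eqP/ffunP=> i; rewrite ffunE; have := layout_bound i PT.
  by case: (T i).
split=> [/allpairsPdep[T' [q [/IHm PT' _ ->]]] | PT]; first exact: insert_at_layout.
have [q qs ->] := insert_at_erase PT; apply/allpairsPdep.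
by exists (erase m T), q; split=> //; apply/IHm/erase_layout.
Qed.

(** Erasing the last inserted letter recovers the smaller arrangement, and the
    position of that letter recovers the slot. *)
Lemma layouts_uniq m : uniq (layouts m).
Proof.
elim: m => [|m IHm] //=; apply: allpairs_uniq_dep => // [T _|]; first exact: slots_uniq.
move=> [T q] [T' q'] /allpairsPdep[U [u [/mem_layouts PU uU [-> ->]]]].
move=> /allpairsPdep[V [v [/mem_layouts PV vV [-> ->]]]] /= eqI.
have eqUV : U = V.
  by rewrite -(erase_insert_at u PU) eqI erase_insert_at.
by subst V; rewrite (insert_at_inj PU uU vV eqI).
Qed.

Section GeneratingFunction.

Variables (R : comPzRingType) (x : 'I_n -> R).

Definition weight T : R := \prod_i x i ^+ RLmin (T i).

Lemma weight_insert_at m T i p : is_layout m T -> (p <= size (T i))%N ->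
  weight (insert_at m T (i, p)) = weight T * x i ^+ (p == size (T i)).
Proof.
move=> PT le_p; rewrite /weight (bigD1 i) //= [in RHS](bigD1 i) //= ffunE eqxx.
rewrite RLmin_insert ?(layout_bound i PT) // exprD mulrAC; congr (_ * _ * _).
by apply: eq_bigr => j /negPf ne_ji; rewrite ffunE /= ne_ji.
Qed.

(** A place that is not at the end of its sequence corresponds to the letter
    following it, so there are [m] such places in all, and each of them keeps
    the weight; the place at the end of the i-th sequence multiplies it by
    [x i]. *)
Lemma sum_weight_slots m T : is_layout m T ->
  \sum_(q <- slots T) weight (insert_at m T q) = weight T * (\sum_i x i + m%:R).
Proof.
move=> PT; rewrite big_allpairs_dep /=.
rewrite -[in RHS](layout_size PT) natr_sum -big_split mulr_sumr /=.
apply: eq_bigr => i _; rewrite big_nat_recr //= weight_insert_at // eqxx expr1.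
rewrite mulrDr addrC mulr_natr; congr (_ + _).
transitivity (\sum_(0 <= p < size (T i)) weight T); last first.
  by rewrite sumr_const_nat subn0.
apply: eq_big_nat => p /andP[_ lt_p].
by rewrite weight_insert_at ?(ltnW lt_p) // ltn_eqF // expr0 mulr1.
Qed.

Lemma sum_weight_layouts m :
  \sum_(T <- layouts m) weight T = \prod_(0 <= k < m) (\sum_i x i + k%:R).
Proof.
elim: m => [|m IHm].
  rewrite big_geq //= big_seq1 /weight big1 // => i _.
  by rewrite ffunE RLmin_nil expr0.
rewrite big_nat_recr //= -IHm big_allpairs_dep /= mulr_suml big_seq [RHS]big_seq.
by apply: eq_bigr => T /mem_layouts; apply: sum_weight_slots.
Qed.

End GeneratingFunction.

End Layouts.

(** * Dispositions as arrangements *)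

Section Words.

Variables m n : nat.
Implicit Type D : predisposition m n.

Definition word D : {ffun 'I_n -> seq nat} := [ffun i => map val (block D i)].

Lemma mem_block D i a : (a \in block D i) = (D.1 a == i).
Proof. by rewrite mem_sort mem_enum inE. Qed.

Lemma block_uniq D i : uniq (block D i).
Proof. by rewrite sort_uniq enum_uniq. Qed.

Lemma word_layout D : is_layout m (word D).
Proof.
move=> x; have [lt_xm|le_mx] := ltnP x m; last first.
  rewrite big1 // => i _; apply/count_memPn; rewrite ffunE.
  by apply/mapP=> -[a _ def_x]; rewrite def_x leqNgt ltn_ord in le_mx.
pose a := Ordinal lt_xm; rewrite (bigD1 (D.1 a)) //= big1 => [|i ne_i].
  rewrite ffunE count_uniq_mem ?(map_inj_uniq val_inj) ?block_uniq //.
  by rewrite -[x]/(val a) (mem_map val_inj) mem_block eqxx.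
apply/count_memPn; rewrite ffunE -[x]/(val a) (mem_map val_inj) mem_block.
by rewrite eq_sym.
Qed.

(** The blocks determine the function, by their elements, and the linear
    orders, by the order in which these are listed. *)
Lemma word_inj : {in dispositions m n &, injective word}.
Proof.
move=> D D'; rewrite !inE => /forallP linD /forallP linD' /ffunP eq_w.
have eqB i : block D i = block D' i.
  by apply: (inj_map val_inj); have := eq_w i; rewrite !ffunE.
have eq1 : D.1 = D'.1.
  by apply/ffunP=> a; apply/esym/eqP; rewrite -mem_block -eqB mem_block.
have eq2 : D.2 = D'.2.
  apply/ffunP=> i.
  rewrite -(precedence_sort (linD i)) -(precedence_sort (linD' i)).
  by congr precedence; apply: eqB.
by case: D D' eq1 eq2 {linD linD' eq_w eqB} => [f r] [f' r'] /= -> ->.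
Qed.

(** A letter is sent to the unique sequence containing it, and each fiber is
    ordered as its sequence lists it. *)
Lemma word_surj T : is_layout m T -> exists2 D, D \in dispositions m n & T = word D.
Proof.
move=> PT; pose s i : seq 'I_m := pmap insub (T i).
have sE i : map val (s i) = T i.
  rewrite pmap_filter; last exact: insubK.
  apply/all_filterP; apply: sub_all (layout_bound i PT) => x /=.
  by rewrite isSome_insub.
have mem_s i a : (a \in s i) = (val a \in T i) by rewrite -sE (mem_map val_inj).
have exT (a : 'I_m) : exists i, val a \in T i := layout_mem PT (ltn_ord a).
pose D : predisposition m n :=
  ([ffun a => xchoose (exT a)], [ffun i => precedence (s i)]).
have fibE i : fiber D i =i s i.
  move=> a; rewrite inE ffunE mem_s; apply/eqP/idP => [<-|ai].
    exact: (xchooseP (exT a)).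
  exact: (layout_inj PT (xchooseP (exT a)) ai).
exists D.
  by rewrite inE; apply/forallP=> i; rewrite ffunE; apply: precedence_linear.
apply/ffunP=> i; rewrite -[LHS]sE [in RHS]ffunE /block /= ffunE; congr map.
apply/esym/sort_precedence => //.
by rewrite -(map_inj_uniq val_inj) sE (layout_uniq i PT).
Qed.

Lemma perm_words : perm_eq [seq word D | D in dispositions m n] (layouts n m).
Proof.
apply: uniq_perm; last move=> T.
- rewrite map_inj_in_uniq ?enum_uniq // => D D'; rewrite !mem_enum; exact: word_inj.
- exact: layouts_uniq.
apply/imageP/idP => [[D _ ->] | /mem_layouts /word_surj //].
by apply/mem_layouts/word_layout.
Qed.

End Words.

Theorem theorem2p1 (m n : nat) (hm : (1 <= m)%N) (hn : (1 <= n)%N) :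
  \sum_(D in dispositions m n)
    \prod_(i < n) ('X_i : {mpoly int[n]}) ^+ RLmin (map val (block D i))
  = \prod_(0 <= k < m) (\sum_(i < n) ('X_i : {mpoly int[n]}) + k%:R).
Proof.
rewrite -sum_weight_layouts -(perm_big _ (perm_words m n)) big_image.
apply: eq_bigr => D _; apply: eq_bigr => i _; by rewrite ffunE.
Qed.
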